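(* Let $(G, T, cap)$ be a network. Then $$\max_{\mathcal{P}} \Vert\mathcal{P}\Vert = \min_{B} cap(B),$$ where $\mathcal{P}$ ranges over (fractional) odd $T$-walk packings in $(G,T,cap)$ and $B$ ranges over odd $T$-walk barriers.
   Context: Graphs are finite, undirected and loopless, with parallel edges allowed. A network $(G,T,cap)$ consists of a graph $G$, a set of terminals $T \subseteq V(G)$ and capacities $cap : E(G) \to \mathbb{R}_+$. An $x-y$ walk is a sequence of edges $(e_1,\dots,e_l)$ with $e_i = v_{i-1}v_i$, $v_0 = x$, $v_l = y$ (vertices and edges may repeat); it is odd if $l$ is odd. A $T$-walk is an $x-y$ walk with $x,y\in T$ distinct (intermediate vertices may also be in $T$). A (fractional) odd $T$-walk packing is a weighted collection $\mathcal{P} = \{\alpha_1\cdot W_1,\dots,\alpha_m\cdot W_m\}$ with weights $\alpha_i \in \mathbb{R}_+$ and odd $T$-walks $W_i$ such that $\sum_i \alpha_i n_i(e) \le cap(e)$ for every $e \in E(G)$, where $n_i(e)$ is the number of occurrences of $e$ in $W_i$. Its value is $\Vert\mathcal{P}\Vert = \sum_i \alpha_i$. A (not necessarily induced) subgraph $B$ of $G$ with $T \subseteq V(B)$ is an odd $T$-walk barrier if there is no odd $T$-walk in $B$. For a subgraph $H$ of $G$, let $I(H)$ be the set of edges of $G$ with exactly one endpoint in $V(H)$, and let $U(H)$ be the set of edges of $G$ with both endpoints in $V(H)$ that are not in $E(H)$. The capacity of a barrier $B$ is $cap(B) = \frac12 cap(I(B)) + cap(U(B))$, where $cap(Y) =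 \sum_{e \in Y} cap(e)$ for $Y\subseteq E(G)$. *)

(* Defs.v *)
From mathcomp Require Import all_boot all_order all_algebra.
From mathcomp Require Import reals.

Set Implicit Arguments.
Unset Strict Implicit.
Unset Printing Implicit Defensive.

Import Order.TTheory GRing.Theory Num.Theory.
Local Open Scope ring_scope.

(* Each edge is sent to its set of endpoints: having exactly two of them rules
   out loops, while ends need not be injective, so edges may be parallel. *)
Record multigraph := Multigraph {
  vertex : finType;
  edge : finType;
  ends : edge -> {set vertex};
  card_ends : forall e : edge, #|ends e| = 2%N
}.

(* V(H) is part of the data: isolated vertices are allowed, and H need not be
   induced. *)
Record subgraph (G : multigraph) := Subgraph {
  sub_vertices : {set vertex G};
  sub_edges : {set edge G};
  sub_closed : forall e, e \in sub_edges -> ends e \subset sub_vertices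
}.

Section Walks.
Variable G : multigraph.
Implicit Types (T : {set vertex G}) (W : seq (edge G)) (H : subgraph G).

(* W = (e_1, ..., e_l) with e_i = v_(i-1) v_i, v_0 = x and v_l = y; the vertices
   v_1, v_2, ... are the successive witnesses z. *)
Fixpoint is_walk (x : vertex G) W (y : vertex G) : bool :=
  if W is e :: W' then [exists z, (ends e == [set x; z]) && is_walk z W' y]
  else x == y.

Definition odd_T_walk T W : Prop :=
  odd (size W) /\
  exists x y, [/\ x \in T, y \in T, x != y & is_walk x W y].

(* An odd T-walk of G is one of H as soon as its edges lie in E(H): it is then
   nonempty, so its vertices are in V(H) by sub_closed. *)
Definition odd_T_walk_barrier T H : Prop :=
  T \subset sub_vertices H /\
  ~ exists W, odd_T_walk T W /\ {subset W <= sub_edges H}.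

Definition I_edges H : {set edge G} :=
  [set e | #|ends e :&: sub_vertices H| == 1%N].

Definition U_edges H : {set edge G} :=
  [set e | (ends e \subset sub_vertices H) && (e \notin sub_edges H)].

End Walks.

Section Packings.
Variables (R : realType) (G : multigraph).
Implicit Types (T : {set vertex G}) (cap : edge G -> R).

Definition cap_of cap (Y : {set edge G}) : R := \sum_(e in Y) cap e.

Definition barrier_cap cap (B : subgraph G) : R :=
  2^-1 * cap_of cap (I_edges B) + cap_of cap (U_edges B).

(* A finite list of weighted walks (alpha_i, W_i). *)
Definition odd_T_walk_packing T cap (P : seq (R * seq (edge G))) : Prop :=
  (forall p, p \in P -> 0 <= p.1 /\ odd_T_walk T p.2) /\
  (forall e, \sum_(p <- P) p.1 * (count_mem e p.2)%:R <= cap e).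

Definition packing_value (P : seq (R * seq (edge G))) : R := \sum_(p <- P) p.1.

End Packings.

(* Main.v *)
(* Weak duality: an odd T-walk either uses an edge of U(B), or leaves V(B) and
   returns to it, crossing I(B) twice.

   Strong duality: by Farkas' lemma it suffices that a minimum barrier has
   capacity at most [\sum_e cap e * l e] for all lengths [l >= 0] giving every
   odd T-walk length at least 1. Let d0(v), d1(v) be the distances, truncated
   at 1, from T to v along even and odd walks, and put p = d0 + d1 and
   q = d0 - d1. If p(v) < 1, both distances are realised from one and the same
   terminal, the branch of v. For 0 < t <= 1, let B_t have the vertices with
   p < t, those with q >= t and those with q <= -t, and the edges joining two
   vertices of the first kind in the same branch or one vertex of the second
   kind with one of the third. Then B_t is a barrier, and for t uniform in
   ]0, 1] the expected weight of an edge e = xy in cap(B_t) is at most l(e).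
   When x and y are not in different branches, this is because e reverses
   parities, so that [|p x - p y| + |q x + q y|], which is twice the maximum of
   [|d0 x - d1 y|] and [|d1 x - d0 y|], is at most 2 l(e).
   So the average capacity of B_t is at most [\sum_e cap e * l e]. *)

From mathcomp Require Import boolp classical_sets.
Require Import Defs.
From mathcomp Require Import all_boot all_order all_algebra.
From mathcomp Require Import reals ring lra.

Set Implicit Arguments.
Unset Strict Implicit.
Unset Printing Implicit Defensive.

Import Order.TTheory GRing.Theory Num.Theory.
Local Open Scope ring_scope.

(** * Farkas' lemma for finitely many linear forms *)

Section Farkas.
Variables (R : realFieldType) (K : finType).
Implicit Types (g x : K -> R).

Definition dot g x := \sum_k g k * x k.

Lemma dot_lincomb (a b : R) (g1 g2 x : K -> R) :
  dot (fun k => a * g1 k + b * g2 k) x = a * dot g1 x + b * dot g2 x.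
Proof.
rewrite /dot !mulr_sumr -big_split /=; apply: eq_bigr => k _; ring.
Qed.

Lemma dot_lincombr (a b : R) (g x1 x2 : K -> R) :
  dot g (fun k => a * x1 k + b * x2 k) = a * dot g x1 + b * dot g x2.
Proof.
rewrite /dot !mulr_sumr -big_split /=; apply: eq_bigr => k _; ring.
Qed.

(* Bartl's induction on the number of inequalities: if the first
   inequality [f >= 0] is not redundant,
     a witness [x0] of this lets one project all the other
   forms onto the hyperplane [f = 0] along [x0]. *)
Lemma farkas (I : eqType) (a : I -> K -> R) (g : K -> R) (r : seq I) :
    (forall x, (forall i, i \in r -> 0 <= \sum_k a i k * x k) ->
       0 <= \sum_k g k * x k) ->
  exists P : seq (R * I), (forall p, p \in P -> 0 <= p.1 /\ p.2 \in r) /\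
    forall k, g k = \sum_(p <- P) p.1 * a p.2 k.
Proof.
elim: r a g => [|i0 r IH] a g.
  (* With no inequality, testing at [- g] makes the sum of squares of [g] nonpositive, so [g]
     vanishes. *)
  move=> imp; have sq : 0 <= \sum_k g k * - g k by exact: imp.
  exists [::]; split=> // k.
  rewrite big_nil; apply/eqP; rewrite -[_ == 0]sqrf_eq0; apply/eqP.
  have sq_ge0 j : true -> 0 <= g j ^+ 2 by rewrite sqr_ge0.
  have sq0 : \sum_k g k ^+ 2 = 0.
    apply/eqP; rewrite eq_le sumr_ge0 // andbT -oppr_ge0 -sumrN.
    by apply: le_trans sq _; apply: ler_sum => j _; rewrite mulrN -expr2.
  exact: (psumr_eq0P sq_ge0 sq0).
move=> imp; pose f := a i0.
have [red|] := pselect (forall x, (forall i, i \in r -> 0 <= dot (a i) x) ->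
                          0 <= dot g x).
  have [P [P_r gE]] := IH _ _ red; exists P; split=> // p /P_r [-> p_r].
  by rewrite inE p_r orbT.
move=> /existsNP [x0 /not_implyP [x0_r /negP]]; rewrite -ltNge => gx0.
have fx0 : dot f x0 < 0.
  rewrite ltNge; apply/negP => fx0; move: gx0; rewrite ltNge => /negP; apply.
  by apply: imp => i; rewrite inE => /orP [/eqP ->|/x0_r].
(* [pr h] is [h] composed with the projection along [x0] onto [f = 0]; the factor 1 gives it the
   shape required by [dot_lincomb]. *)
pose pr (h : K -> R) k := 1 * h k + (- (dot h x0 / dot f x0)) * f k.
have [|P [P_r gE]] := IH (fun i => pr (a i)) (pr g).
  move=> x x_r.
  pose y k := 1 * x k + (- (dot f x / dot f x0)) * x0 k.
  have yE h : dot h y = dot (pr h) x.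
    by rewrite dot_lincombr dot_lincomb; field; rewrite lt_eqF.
  have -> : \sum_k pr g k * x k = dot g y by rewrite yE.
  apply: imp => i; rewrite inE => /orP [/eqP ->|ir].
    suff -> : \sum_k a i0 k * y k = 0 by [].
    by rewrite -/(dot f y) dot_lincombr; field; rewrite lt_eqF.
  by rewrite -/(dot (a i) y) yE; exact: x_r.
(* Coefficient of [f] once the projections are undone. It is nonnegative: at [x0] both [g] and [f]
   are negative, while the other forms are nonnegative. *)
pose c := dot g x0 / dot f x0 - \sum_(p <- P) p.1 * (dot (a p.2) x0 / dot f x0).
exists ((c, i0) :: P); split=> [p|k].
  rewrite !inE => /orP [/eqP -> /=|/P_r [-> ->]]; last by rewrite orbT.
  rewrite eqxx; split=> //.
  rewrite subr_ge0; apply: (@le_trans _ _ 0).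
    rewrite big_seq; apply: sumr_le0 => p' /P_r [p0 pr'].
    by rewrite mulr_ge0_le0 // mulr_ge0_le0 ?invr_le0 ?x0_r // ltW.
  by rewrite ltW // nmulr_rgt0 // invr_lt0.
have -> : g k = pr g k + dot g x0 / dot f x0 * f k by rewrite /pr; ring.
rewrite gE big_cons /= /c mulrBl -/f /pr.
under eq_bigr do rewrite mul1r mulrDr mulNr mulrN mulrA.
rewrite sumrB -mulr_suml; ring.
Qed.

End Farkas.

Lemma ltn_count (T : eqType) (P Q : pred T) (s : seq T) (x : T) :
  subpred P Q -> x \in s -> Q x -> ~~ P x -> (count P s < count Q s)%N.
Proof.
move=> PQ + Qx nPx; elim: s => //= y s IH;
  rewrite inE => /orP [/eqP <-|/IH lt_s].
  by rewrite Qx (negbTE nPx) ltnS sub_count.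
by rewrite -addnS leq_add //; case: (P y) (PQ y) => // ->.
Qed.

(** * Averages over a threshold uniform in ]0, 1] *)

Section StepFunctions.
Variable R : realType.
Implicit Types (a b c v x y : R) (f : R -> R) (s : seq (R * R)).

(** For [a <= b], [clamp a b x - a] is the integral over ]a, b] of the indicator of [t <= x]. *)
Definition clamp a b x := Num.max a (Num.min x b).

(* The upper integral of [f] over ]0, 1] is at most [v], as witnessed by a step
   function whose jumps are listed in [s]. *)
Definition avg_le f v := exists s,
  (forall t, 0 < t <= 1 -> f t <= \sum_(p <- s) p.1 * (t <= p.2)%R%:R) /\
  \sum_(p <- s) p.1 * clamp 0 1 p.2 <= v.

Lemma clamp_split a y b x : a <= y -> y <= b ->
  clamp a b x - a = (clamp a y x - a) + (clamp y b x - y).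
Proof.
move=> ay yb; rewrite /clamp.
case: (leP x b) (leP x y) => [xb|bx] [xy|yx].
all: by do 3?[case: leP => ?]; lra.
Qed.

(** Induction on the number of jumps strictly between [a] and [b]: cutting at such a jump removes it
    from both halves. Without one, the step function is constant on ]a, b] and its value at [b]
    decides. *)
Lemma step_integral a b c s : a <= b ->
    (forall t, a < t <= b -> c <= \sum_(p <- s) p.1 * (t <= p.2)%R%:R) ->
  (b - a) * c <= \sum_(p <- s) p.1 * (clamp a b p.2 - a).
Proof.
have [n le_n] := ubnP (count (fun p => a < p.2 < b) s).
elim: n => // n IH in a b le_n * => ab c_le; rewrite ltnS in le_n.
have [/hasP [p0 p0s /andP [ap pb]]|/hasPn no_break] :=
  boolP (has (fun p => a < p.2 < b) s).
  have IHl : (p0.2 - a) * c <= \sum_(p <- s) p.1 * (clamp a p0.2 p.2 - a).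
    apply: IH (ltW ap) _ => [|t /andP [at_ tp]]; last first.
      by apply: c_le; rewrite at_ (le_trans tp) ?ltW.
    apply: leq_trans le_n; apply: (ltn_count _ p0s);
      rewrite ?ap ?ltxx ?andbF //.
    by move=> p /andP [-> /lt_trans->].
  have IHr : (b - p0.2) * c <= \sum_(p <- s) p.1 * (clamp p0.2 b p.2 - p0.2).
    apply: IH (ltW pb) _ => [|t /andP [pt tb]]; last first.
      by apply: c_le; rewrite tb (lt_trans ap).
    apply: leq_trans le_n; apply: (ltn_count _ p0s); rewrite ?ap ?ltxx //.
    by move=> p /andP [/(lt_trans ap) -> ->].
  have -> : (b - a) * c = (p0.2 - a) * c + (b - p0.2) * c by ring.
  apply: le_trans (lerD IHl IHr) _; rewrite -big_split /=.
  by apply: ler_sum => p _; rewrite -mulrDr -(clamp_split _ (ltW ap) (ltW pb)).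
have [->|a_neq_b] := eqVneq a b.
  rewrite subrr mul0r big1 // => p _; rewrite /clamp.
  by rewrite (@max_l _ _ b) ?subrr ?mulr0 // ge_min lexx orbT.
have lt_ab : a < b by rewrite lt_neqAle a_neq_b.
apply: le_trans (_ : (b - a) * (\sum_(p <- s) p.1 * (b <= p.2)%R%:R) <= _).
  by rewrite ler_pM2l ?subr_gt0 // c_le // lt_ab lexx.
rewrite mulr_sumr big_seq [leRHS]big_seq; apply: ler_sum => p /no_break.
rewrite negb_and -!leNgt /clamp => ps.
case: (leP b p.2) => bp; first by rewrite (max_r (ltW lt_ab)) mulr1 mulrC.
have pa : p.2 <= a by move: ps; rewrite [b <= _]leNgt bp orbF.
by rewrite max_l // subrr !mulr0.
Qed.

Lemma avg_leP f c v :
  avg_le f v -> (forall t, 0 < t <= 1 -> c <= f t) -> c <= v.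
Proof.
move=> [s [f_le s_le]] c_le; apply: le_trans s_le.
have := @step_integral 0 1 c s ler01; rewrite subr0 mul1r.
under eq_bigr do rewrite subr0.
by apply=> t t01; apply: le_trans (f_le t t01); apply: c_le.
Qed.

Lemma avg_leZ k f v : 0 <= k -> avg_le f v -> avg_le (fun t => k * f t) (k * v).
Proof.
move=> k0 [s [f_le s_le]]; exists [seq (k * p.1, p.2) | p <- s]; split.
  move=> t /f_le ft; rewrite big_map /=; under eq_bigr do rewrite -mulrA.
  by rewrite -mulr_sumr ler_wpM2l.
rewrite big_map /=; under eq_bigr do rewrite -mulrA.
by rewrite -mulr_sumr ler_wpM2l.
Qed.

Lemma avg_le_sum (J : Type) (r : seq J) (f : J -> R -> R) (v : J -> R) :
  (forall j, avg_le (f j) (v j)) ->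
  avg_le (fun t => \sum_(j <- r) f j t) (\sum_(j <- r) v j).
Proof.
move=> favg; elim: r => [|j r [s [fs sv]]].
  by exists [::]; split=> [t _|]; rewrite !big_nil.
have [sj [fj svj]] := favg j; exists (sj ++ s); split=> [t t01|].
  by rewrite big_cons big_cat lerD ?fj ?fs.
by rewrite big_cons big_cat lerD.
Qed.

Lemma avg_leD f1 f2 v1 v2 :
  avg_le f1 v1 -> avg_le f2 v2 -> avg_le (fun t => f1 t + f2 t) (v1 + v2).
Proof.
move=> [s1 [f1s s1v]] [s2 [f2s s2v]]; exists (s1 ++ s2).
by split=> [t t01|]; rewrite big_cat lerD ?f1s ?f2s.
Qed.

Lemma avg_leW f g v w : avg_le g w ->
  (forall t, 0 < t <= 1 -> f t <= g t) -> w <= v -> avg_le f v.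
Proof.
move=> [s [gs sw]] fg wv; exists s; split=> [t t01|]; last exact: le_trans wv.
by apply: le_trans (gs t t01); apply: fg.
Qed.

(** Truncated positive and negative parts of [x], tabulated together so that every case is linear
    arithmetic. *)
Variant clamp_pm_spec x : R -> R -> Prop :=
| ClampGe1 of 1 <= x : clamp_pm_spec x 1 0
| ClampGe0 of 0 <= x <= 1 : clamp_pm_spec x x 0
| ClampLe0 of - 1 <= x <= 0 : clamp_pm_spec x 0 (- x)
| ClampLeN1 of x <= - 1 : clamp_pm_spec x 0 1.

Lemma clampP x : clamp_pm_spec x (clamp 0 1 x) (clamp 0 1 (- x)).
Proof.
rewrite /clamp; have [x0|/ltW x0] := leP 0 x.
  rewrite (min_l (_ : - x <= 1)) ?(max_l (_ : - x <= 0)); try lra.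
  by case: (leP x 1) => ?; rewrite max_r ?ler01 //;
    [constructor 2|constructor 1]; lra.
have x0' : 0 <= - x by lra.
rewrite (min_l (_ : x <= 1)) ?(max_l (_ : x <= 0)); try lra.
by case: (leP (- x) 1) => ?; rewrite max_r ?ler01 //;
  [constructor 3|constructor 4]; lra.
Qed.

Lemma clamp_le a b : a <= b -> clamp 0 1 a <= clamp 0 1 b.
Proof. by case: (clampP a) => ?; case: (clampP b) => ?; lra. Qed.

(** As [x] moves from [b] to [a], [clamp 0 1 x] varies only while [x] is positive and
    [clamp 0 1 (- x)] only while it is negative, so the two variations share the distance
    travelled. *)
Lemma clamp_sym_lipschitz a b :
  `|clamp 0 1 a - clamp 0 1 b| + `|clamp 0 1 (- a) - clamp 0 1 (- b)| <=
  `|a - b|.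
Proof.
wlog ab : a b / b <= a => [th|].
  have [/th //|/ltW/th] := leP b a.
  by rewrite ![`|clamp 0 1 b - _|]distrC ![`|clamp _ _ (- b) - _|]distrC
    (distrC b).
rewrite [X in X + _ <= _]ger0_norm ?subr_ge0 ?clamp_le //.
rewrite [X in _ + X <= _]ler0_norm ?subr_le0 ?clamp_le ?lerN2 //.
rewrite [leRHS]ger0_norm ?subr_ge0 //.
by case: (clampP a) => ?; case: (clampP b) => ?; lra.
Qed.

Lemma clamp_lipschitz a b : `|clamp 0 1 a - clamp 0 1 b| <= `|a - b|.
Proof. by apply: le_trans (clamp_sym_lipschitz a b); rewrite lerDl. Qed.

(** The two comparisons disagree exactly for [t] between [a] and [b]. *)
Lemma avg_le_addb a b : avg_le (fun t => ((t <= a)%R (+) (t <= b)%R)%:R)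
  `|clamp 0 1 a - clamp 0 1 b|.
Proof.
wlog ab : a b / b <= a => [th|].
  have [/th //|/ltW/th le_ba] := leP b a.
  by apply: avg_leW le_ba _ _; [move=> t _; rewrite addbC|rewrite distrC].
exists [:: (1, a); (- 1, b)]; split=> [t _|]; rewrite !big_cons big_nil /=.
  have [tb|_] := leP t b; first by rewrite (le_trans tb ab) /=; lra.
  by case: (t <= a) => /=; lra.
by rewrite ger0_norm ?subr_ge0 ?clamp_le //; lra.
Qed.

End StepFunctions.

Lemma sum_uniq_sub_le (R : numDomainType) (S : eqType) (f : S -> R) (s1 s2 :
  seq S) :
    (forall x, 0 <= f x) -> uniq s1 -> {subset s1 <= s2} ->
  \sum_(x <- s1) f x <= \sum_(x <- s2) f x.
Proof.
move=> f0; elim: s1 s2 => [|x s1 IH] s2 /=; first by rewrite big_nil sumr_ge0.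
move=> /andP [x_s1 /IH{}IH] sub.
have xs2 : x \in s2 by apply: sub; rewrite mem_head.
rewrite big_cons (perm_big _ (perm_to_rem xs2)) big_cons lerD2l;
  apply: IH => y ys1.
have := sub y; rewrite inE ys1 orbT => /(_ isT).
rewrite (perm_mem (perm_to_rem xs2)) inE => /predU1P [yx|//].
by rewrite -yx ys1 in x_s1.
Qed.

(** * Walks, their lengths, and shortening *)

Section Walks.
Variable G : multigraph.
Implicit Types (x y z : vertex G) (e : edge G) (W : seq (edge G)).

Lemma endsP e : exists x y, ends e = [set x; y].
Proof. by have /eqP/cards2P [x [y [_ ->]]] := card_ends e; exists x, y. Qed.

Lemma ends_neq x y e : ends e = [set x; y] -> x != y.
Proof. by move=> exy; have := card_ends e; rewrite exy cards2; case: eqP. Qed.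

Lemma walk_cons x y z e W :
  ends e = [set x; z] -> is_walk z W y -> is_walk x (e :: W) y.
Proof. by move=> ez Wy; apply/existsP; exists z; rewrite ez eqxx. Qed.

Lemma walk_cat x y z W1 W2 :
  is_walk x W1 y -> is_walk y W2 z -> is_walk x (W1 ++ W2) z.
Proof.
elim: W1 x => [|e W1 IH] x /=; first by move=> /eqP ->.
move=> /existsP [v /andP [ev /IH W1v]] /W1v W12v.
by apply/existsP; exists v; rewrite ev.
Qed.

Lemma walk_rcons x y z e W :
  is_walk x W y -> ends e = [set y; z] -> is_walk x (rcons W e) z.
Proof.
by move=> Wy ez; rewrite -cats1; apply: walk_cat Wy _;
  apply: walk_cons ez _ => /=.
Qed.

Lemma walk_rev x y W : is_walk x W y -> is_walk y (rev W) x.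
Proof.
elim: W x => [|e W IH] x /=; first by rewrite eq_sym.
move=> /existsP [v /andP [/eqP ev /IH Wv]]; rewrite rev_cons.
by apply: walk_rcons Wv _; rewrite ev setUC.
Qed.

Variable R : realType.
Variable l : edge G -> R.
Hypothesis l_ge0 : forall e, 0 <= l e.

Definition walk_len W := \sum_(e <- W) l e.

Lemma walk_len_ge0 W : 0 <= walk_len W.
Proof. exact: sumr_ge0. Qed.

Lemma walk_len_cat W1 W2 : walk_len (W1 ++ W2) = walk_len W1 + walk_len W2.
Proof. exact: big_cat. Qed.

Lemma walk_len_rcons W e : walk_len (rcons W e) = walk_len W + l e.
Proof. by rewrite -cats1 walk_len_cat /walk_len big_seq1. Qed.

Lemma walk_len_rev W : walk_len (rev W) = walk_len W.
Proof. by rewrite /walk_len (perm_big W) // perm_rev. Qed.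

Lemma walk_len_count W : walk_len W = \sum_e (count_mem e W)%:R * l e.
Proof.
rewrite /walk_len; elim: W => [|e W IH]; first by rewrite big_nil big1 // => e;
  rewrite mul0r.
rewrite big_cons IH /=; under [RHS]eq_bigr do rewrite natrD mulrDl.
rewrite big_split /=; congr (_ + _);
  rewrite (bigD1 e) //= eqxx mul1r big1 ?addr0 //.
by move=> f fe; rewrite eq_sym (negbTE fe) mul0r.
Qed.

(* A state of a walk: last edge, endpoint, parity of the number of edges. *)
Definition walk_step (s s' : edge G * vertex G * bool) :=
  (ends s'.1.1 == [set s.1.2; s'.1.2]) && (s'.2 == ~~ s.2).

Lemma walk_to_path s W y : is_walk s.1.2 W y -> exists p,
  [/\ path walk_step s p, map (fun s => s.1.1) p = W,
      (last s p).1.2 = y & (last s p).2 = s.2 (+) odd (size W)].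
Proof.
elim: W s => [|e W IH] s /=; first by move=> /eqP <-; exists [::];
  rewrite addbF.
move=> /existsP [v /andP [ev /(IH (e, v, ~~ s.2)) [p [sp pW py pb]]]].
exists ((e, v, ~~ s.2) :: p); rewrite /= pW pb /walk_step /= ev eqxx.
by split=> //; case: (s.2); case: odd.
Qed.

Lemma path_to_walk s p : path walk_step s p ->
  is_walk s.1.2 (map (fun s => s.1.1) p) (last s p).1.2 /\
  (last s p).2 = s.2 (+) odd (size p).
Proof.
elim: p s => [|s' p IH] s /=; first by rewrite addbF.
move=> /andP [/andP [/eqP es /eqP sb] /IH [pw pb]]; split; last first.
  by rewrite pb sb; case: (s.2); case: odd.
exact: walk_cons es pw.
Qed.

(** Cutting out the cycles of the path of states keeps end and parity and only deletes edges. Hence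
    finitely many walks suffice for the linear program. *)
Lemma odd_T_walk_shorten T W : odd_T_walk T W ->
  exists W', [/\ odd_T_walk T W',
    (size W' <= #|{: edge G * vertex G * bool}|)%N & walk_len W' <= walk_len W].
Proof.
case: W => [[]//|e W] [oddW [x [y [xT yT xy /= /existsP [z /andP [/eqP ez
  Wy]]]]]].
(* A state has a last edge, so the path starts from the state reached after [e], which has odd
   parity. *)
have [p [sp pW py pb]] := @walk_to_path (e, z, true) W y Wy; subst W.
case/shortenP: sp py pb => p' sp' up' sub py pb.
have [p'w p'b] := path_to_walk sp'.
exists (e :: map (fun s => s.1.1) p'); split.
- split; last by exists x, y; split=> //; rewrite -py; apply: walk_cons p'w.
  move: oddW pb; rewrite /= !size_map p'b /= => /negbTE ->.
  by case: odd.
- by rewrite [size _]/= size_map -[_.+1]/(size ((e, z,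
  true) :: p')) -(card_uniqP up') max_card.
rewrite /walk_len !big_cons lerD2l !big_map; apply: sum_uniq_sub_le => //.
by case/andP: up'.
Qed.

End Walks.

(** * Weak duality *)

Section WeakDuality.
Variables (R : realType) (G : multigraph).
Implicit Types (H : subgraph G) (cap : edge G -> R) (T : {set vertex G}).

(** The coefficient of [cap e] in the capacity of [H], also used as an edge length. *)
Definition barrier_weight H e : R :=
  2^-1 * (e \in I_edges H)%:R + (e \in U_edges H)%:R.

Lemma barrier_weight_ge0 H e : 0 <= barrier_weight H e.
Proof. by rewrite /barrier_weight; do 2!case: (e \in _) => /=; lra. Qed.

Lemma barrier_capE cap H :
  barrier_cap cap H = \sum_e cap e * barrier_weight H e.
Proof.
rewrite /barrier_cap /cap_of big_mkcond [in X in _ + X]big_mkcond mulr_sumr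
  -big_split /=.
apply: eq_bigr => e _; rewrite /barrier_weight.
by do 2!case: (e \in _) => /=; lra.
Qed.

Lemma mem_I_edges H e x y : ends e = [set x; y] ->
  (e \in I_edges H) = (x \in sub_vertices H) (+) (y \in sub_vertices H).
Proof.
move=> exy; rewrite inE exy setIUl cardsU.
have card1 z : #|[set z] :&: sub_vertices H| = (z \in sub_vertices H).
  have [zH|zH] := boolP (z \in _).
    by rewrite (setIidPl _) ?cards1 ?sub1set.
  by apply/eqP; rewrite cards_eq0 setI_eq0 disjoints1.
rewrite !card1 setIACA setIid (_ : [set x] :&: [set y] = set0).
  by rewrite set0I cards0 subn0; do 2!case: (_ \in _).
by apply/eqP; rewrite setI_eq0 disjoints1 inE (ends_neq exy).
Qed.

Lemma mem_U_edges H e x y : ends e = [set x; y] ->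
  (e \in U_edges H) =
  [&& x \in sub_vertices H, y \in sub_vertices H & e \notin sub_edges H].
Proof. by move=> exy; rewrite inE exy subUset !sub1set andbA. Qed.

(** From outside [H], the walk still has to enter it, which costs one half. From inside, leaving
    [E(H)] costs 1 at once on [U(H)], or one half on [I(H)] and another half for the return. *)
Lemma barrier_weight_walk H x W y : is_walk x W y -> y \in sub_vertices H ->
  if x \in sub_vertices H
  then {subset W <= sub_edges H} \/ 1 <= walk_len (barrier_weight H) W
  else 2^-1 <= walk_len (barrier_weight H) W.
Proof.
move=> + yH; elim: W x => [|e W IH] x /=; first by move=> /eqP ->; rewrite yH;
  left.
move=> /existsP [z /andP [/eqP ez /IH{}IH]].
have W0 := walk_len_ge0 (barrier_weight_ge0 H) W.
rewrite /walk_len big_cons -/(walk_len _ W).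
have wE := (mem_I_edges H ez, mem_U_edges H ez).
have e0 := barrier_weight_ge0 H e.
case: ifP IH => zH IH; case: ifP => xH;
  rewrite [X in X + _]/barrier_weight !wE zH xH /=.
- have [eH|eH] := boolP (e \in sub_edges H); last by right => /=; lra.
  case: IH => [sub|]; last by right => /=; lra.
  by left=> f; rewrite inE => /predU1P [->|/sub].
- by lra.
- by right; lra.
- by lra.
Qed.

Lemma odd_T_walk_weight T H W : odd_T_walk_barrier T H -> odd_T_walk T W ->
  1 <= walk_len (barrier_weight H) W.
Proof.
move=> [/subsetP TH noW] TW; case: (TW) => [_ [x [y [/TH xH /TH yH _ Wy]]]].
have := barrier_weight_walk Wy yH; rewrite xH => -[sub|//].
by case: noW; exists W.
Qed.

Lemma packing_le_barrier T cap P H :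
  odd_T_walk_packing T cap P -> odd_T_walk_barrier T H ->
  packing_value P <= barrier_cap cap H.
Proof.
move=> [P_walks P_cap] HB; rewrite barrier_capE.
apply: (@le_trans _ _ (\sum_(p <- P) p.1 * walk_len (barrier_weight H) p.2)).
  rewrite /packing_value big_seq [leRHS]big_seq;
    apply: ler_sum => p /P_walks [p0 pW].
  by rewrite ler_peMr // (odd_T_walk_weight HB).
under eq_bigr do rewrite walk_len_count mulr_sumr.
rewrite exchange_big /=; apply: ler_sum => e _.
under eq_bigr do rewrite mulrA.
by rewrite -mulr_suml ler_wpM2r ?barrier_weight_ge0.
Qed.

End WeakDuality.

(** * Distances by parity, and branches *)

Section Rounding.
Variables (R : realType) (G : multigraph) (T : {set vertex G}) (l :
  edge G -> R).
Hypothesis l_ge0 : forall e, 0 <= l e.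
Hypothesis l_feasible : forall W, odd_T_walk T W -> 1 <= walk_len l W.
Implicit Types (s v x y : vertex G) (W : seq (edge G)) (b : bool) (t : R).

Definition walk_from s b v W := [/\ s \in T, is_walk s W v & odd (size W) = b].

(** The element 1 truncates the distance and keeps the set nonempty where no walk of parity [b]
    reaches [v]. *)
Definition dist b v : R :=
  inf [set r | r = 1 \/ exists s W,
    walk_from s b v W /\ r = walk_len l W]%classic.

Lemma dist_lb b v r : r <= 1 ->
  (forall s W, walk_from s b v W -> r <= walk_len l W) -> r <= dist b v.
Proof.
move=> r1 rW; apply: lb_le_inf; first by exists 1; left.
by move=> _ [->//|[s [W [/rW ? ->]]]].
Qed.

Lemma dist_ge0 b v : 0 <= dist b v.
Proof. by apply: dist_lb => // s W _; exact: walk_len_ge0. Qed.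

Lemma dist_has_lbound b v :
  has_lbound [set r | r = 1 \/ exists s W,
    walk_from s b v W /\ r = walk_len l W]%classic.
Proof. by exists 0 => _ [->//|[s [W [_ ->]]]]; exact: walk_len_ge0. Qed.

Lemma dist_le1 b v : dist b v <= 1.
Proof. by apply: (ge_inf (dist_has_lbound b v)); left. Qed.

Lemma dist_le b v s W : walk_from s b v W -> dist b v <= walk_len l W.
Proof. by move=> sW; apply: (ge_inf (dist_has_lbound b v)); right;
  exists s, W. Qed.

Lemma dist_lt b v r : dist b v < r -> r <= 1 ->
  exists s W, walk_from s b v W /\ walk_len l W < r.
Proof.
move=> + r1; rewrite ltNge => /negP lt_r; apply: contrapT => noW; apply: lt_r.
apply: dist_lb => // s W sW; rewrite leNgt; apply/negP => Wr.
by apply: noW; exists s, W.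
Qed.

Lemma walk_from_step s b v y W e : walk_from s b v W -> ends e = [set v; y] ->
  walk_from s (~~ b) y (rcons W e).
Proof.
move=> [sT Wv <-] ey; split=> //; first exact: walk_rcons Wv ey.
by rewrite size_rcons.
Qed.

Lemma dist_edge b e x y : ends e = [set x; y] ->
  dist (~~ b) y <= dist b x + l e.
Proof.
move=> exy; rewrite -lerBlDr; apply: dist_lb => [|s W sW].
  by have := dist_le1 (~~ b) y; have := l_ge0 e; lra.
by have := dist_le (walk_from_step sW exy); rewrite walk_len_rcons; lra.
Qed.

Lemma dist_edge_norm b e x y : ends e = [set x; y] ->
  `|dist (~~ b) y - dist b x| <= l e.
Proof.
move=> exy; have := dist_edge b exy;
  have := dist_edge (~~ b) (etrans exy (setUC _ _)).
by rewrite negbK ler_norml; lra.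
Qed.

(** If the terminals differed, [W] followed by the reverse of [W'] would be an odd [T]-walk of
    length below 1. *)
Lemma walk_from_join s s' b v W W' :
  walk_from s b v W -> walk_from s' (~~ b) v W' ->
  walk_len l W + walk_len l W' < 1 -> s = s'.
Proof.
move=> [sT Wv Wb] [s'T W'v W'b] lt1; apply/eqP; apply: contraT => ss'.
have : odd_T_walk T (W ++ rev W').
  split; first by rewrite size_cat size_rev oddD Wb W'b; case: (b).
  by exists s, s'; split=> //; apply: walk_cat Wv (walk_rev W'v).
by move/l_feasible; rewrite walk_len_cat walk_len_rev leNgt lt1.
Qed.

Definition in_branch v s := exists W W',
  [/\ walk_from s false v W,
    walk_from s true v W' & walk_len l W + walk_len l W' < 1].

Definition branch v := [pick s | `[< in_branch v s >]].

(** Uniqueness of the terminal: of two pairs of walks with totals below 1, one of the two mixed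
    pairs also has total below 1, and [walk_from_join] applies to it. *)
Lemma branchE v s : in_branch v s -> branch v = Some s.
Proof.
move=> [W [W' [sW sW' lt1]]]; rewrite /branch.
case: pickP => [s' /asboolP [U [U' [sU sU' lt1']]]|/(_ s)/asboolP []];
  last first.
  by exists W, W'.
congr Some; have [lt_WU|le_WU] := ltP (walk_len l W + walk_len l U') 1.
  by have := walk_from_join sW sU' lt_WU.
by apply: (walk_from_join sU sW'); lra.
Qed.

(* Length of the odd closed walk made of the two walks to [v], when [v] lies
   in a branch. *)
Definition loop_dist v := dist false v + dist true v.
Definition skew v := dist false v - dist true v.

Lemma skew_loop_dist v : - loop_dist v <= skew v <= loop_dist v.
Proof. by have := dist_ge0 false v; have := dist_ge0 true v;
  rewrite /loop_dist /skew; lra. Qed.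

Lemma loop_dist_ge0 v : 0 <= loop_dist v.
Proof. by rewrite addr_ge0 ?dist_ge0. Qed.

(* Both walks continue through [e], and closing them up shows that they start
   at the same terminal. *)
Lemma branch_edge b e x y : ends e = [set x; y] ->
  dist b x + dist b y + l e < 1 -> branch x = branch y.
Proof.
move=> exy lt1; have le0 := l_ge0 e.
have x0 := dist_ge0 b x; have y0 := dist_ge0 b y.
(* Half of the slack: two walks within [d] of their infima, together with [e], still have total
   length below 1. *)
pose d := (1 - (dist b x + dist b y + l e)) / 2.
have [||s [W [sW Wlt]]] := @dist_lt b x (dist b x + d);
  [by rewrite /d; lra..|].
have [||s' [W' [sW' W'lt]]] := @dist_lt b y (dist b y + d);
  [by rewrite /d; lra..|].
have exy' : ends e = [set y; x] by rewrite exy setUC.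
have We := walk_from_step sW exy; have W'e := walk_from_step sW' exy'.
have Wle := walk_len_rcons l W e; have W'le := walk_len_rcons l W' e.
have xlt : walk_len l W + walk_len l (rcons W' e) < 1 by rewrite /d in Wlt W'lt
  *; lra.
have ylt : walk_len l W' + walk_len l (rcons W e) < 1 by rewrite /d in Wlt W'lt
  *; lra.
have ss' := walk_from_join sW W'e xlt; subst s'.
rewrite (@branchE x s) ?(@branchE y s) //.
  by case: (b) in sW sW' We W'e *;
    [exists (rcons W e), W' | exists W', (rcons W e)];
    split=> //; lra.
by case: (b) in sW sW' We W'e *;
  [exists (rcons W' e), W | exists W, (rcons W' e)];
  split=> //; lra.
Qed.

Lemma dist_terminal s : s \in T -> dist false s = 0.
Proof.
move=> sT; apply: le_anti; rewrite dist_ge0 andbT.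
have : walk_from s false s [::] by split=> //=.
by move/dist_le; rewrite /walk_len big_nil.
Qed.

(** The empty walk is an even walk to [s], so an odd walk to [s] of length below 1 must start at [s]
    too. *)
Lemma branch_terminal s : s \in T -> loop_dist s < 1 -> branch s = Some s.
Proof.
move=> sT; rewrite /loop_dist dist_terminal // add0r => lt1.
have [s' [W [sW Wlt]]] := dist_lt lt1 (lexx _).
have s0 : walk_from s false s [::] by split=> //=.
have Wlt' : walk_len l [::] + walk_len l W < 1 by rewrite {1}/walk_len big_nil
  add0r.
have ss' := walk_from_join s0 sW Wlt'; subst s'.
by apply: branchE; exists [::], W.
Qed.

(** * The threshold barriers *)

Definition in_threshold t v := [|| loop_dist v < t,
  t <= skew v | t <= - skew v].

Definition threshold_rel t x y :=
  [|| [&& loop_dist x < t, loop_dist y < t & branch x == branch y],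
      (t <= skew x) && (t <= - skew y) | (t <= skew y) && (t <= - skew x)].

Definition threshold_vertices t : {set vertex G} := [set v | in_threshold t v].
Definition threshold_edges t : {set edge G} :=
  [set e | [exists x, exists y, (ends e == [set x; y]) && threshold_rel t x y]].

Lemma threshold_rel_sym t x y : threshold_rel t x y = threshold_rel t y x.
Proof.
rewrite /threshold_rel [in RHS]eq_sym; congr (_ || _); last exact: orbC.
by rewrite andbCA.
Qed.

Lemma mem_threshold_edges t e x y : ends e = [set x; y] ->
  (e \in threshold_edges t) = threshold_rel t x y.
Proof.
move=> exy; rewrite inE; apply/existsP/idP =>
  [[x' /existsP [y' /andP [/eqP exy' r']]]|r].
  have xy' := ends_neq exy.
  have : x \in [set x'; y'] by rewrite -exy' exy set21.
  have : y \in [set x'; y'] by rewrite -exy' exy set22.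
  rewrite !inE => /orP [] /eqP yE /orP [] /eqP xE; subst x y => //.
  - by rewrite eqxx in xy'.
  - by rewrite threshold_rel_sym.
  - by rewrite eqxx in xy'.
by exists x; apply/existsP; exists y; rewrite exy eqxx.
Qed.

Lemma threshold_closed t e :
  e \in threshold_edges t -> ends e \subset threshold_vertices t.
Proof.
have [x [y exy]] := endsP e;
  rewrite (mem_threshold_edges _ exy) exy subUset !sub1set !inE.
by rewrite /in_threshold => /or3P [/and3P [-> ->]|/andP [-> ->]|/andP [-> ->]];
  rewrite ?orbT.
Qed.

Definition threshold_barrier t : subgraph G := Subgraph (@threshold_closed t).

(** Walks of parity [b] are shorter than those of the other parity by at least [t], in truncated
    distance. *)
Definition on_side t b v := t <= (if b then skew v else - skew v).

(** Each edge either preserves the branch or switches the side. The kinds of vertices never mix,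
    because the skew is at most [loop_dist] in absolute value. *)
Lemma threshold_walk t W x y : 0 < t -> is_walk x W y ->
    {subset W <= sub_edges (threshold_barrier t)} ->
  (loop_dist x < t -> loop_dist y < t /\ branch y = branch x) /\
  (forall b, on_side t b x -> on_side t (b (+) odd (size W)) y).
Proof.
move=> t0; elim: W x => [|e W IH] x /=.
  by move=> /eqP -> _; split=> // b; rewrite addbF.
move=> /existsP [z /andP [/eqP ez Wy]] sub.
have [|IHb IHs] := IH z Wy; first by move=> f fW; apply: sub;
  rewrite inE fW orbT.
have : e \in threshold_edges t by apply: sub; rewrite mem_head.
have px := skew_loop_dist x; rewrite (mem_threshold_edges _ ez).
move=> /or3P [/and3P [xt zt /eqP xz]|/andP [xt zt]|/andP [zt xt]]; split.
- by rewrite xz => _; apply: IHb.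
- by move=> b; rewrite {1}/on_side; case: b => side; exfalso; lra.
- by move=> xt'; exfalso; lra.
- move=> b; case: b => [_|]; last by rewrite {1}/on_side => side; exfalso; lra.
  by have := IHs false zt; rewrite /= negbK.
- by move=> xt'; exfalso; lra.
- move=> b; case: b => [|_]; first by rewrite {1}/on_side => side; exfalso; lra.
  by have := IHs true zt.
Qed.

Lemma skew_terminal s : s \in T -> skew s = - loop_dist s.
Proof. by move=> sT; rewrite /skew /loop_dist dist_terminal // sub0r add0r. Qed.

(** A terminal is either alone among terminals in its branch or on the even side. An odd walk from
    the even side would end on the odd side, where the skew is positive, but terminals have skew at
    most 0. *)
Lemma threshold_barrierP t : 0 < t <=
  1 -> odd_T_walk_barrier T (threshold_barrier t).
Proof.
move=> /andP [t0 t1]; split.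
  apply/subsetP => s sT; rewrite inE /in_threshold skew_terminal // opprK.
  by case: ltP => //=; rewrite orbT.
move=> [W [[oddW [x [y [xT yT /eqP xy Wy]]]] sub]].
have [keep_branch keep_side] := threshold_walk t0 Wy sub.
have [xt|xt] := ltP (loop_dist x) t.
  have [yt] := keep_branch xt.
  rewrite !branch_terminal ?(lt_le_trans _ t1) // => -[yx]; exact: xy.
have := keep_side false; rewrite oddW /on_side /= !skew_terminal // opprK =>
  /(_ xt).
by have := loop_dist_ge0 y; lra.
Qed.

(** * Average weight of an edge *)

Lemma threshold_weightE t e x y : ends e = [set x; y] ->
  barrier_weight R (threshold_barrier t) e =
    2^-1 * (in_threshold t x (+) in_threshold t y)%:R +
    [&& in_threshold t x, in_threshold t y & ~~ threshold_rel t x y]%:R.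
Proof.
move=> exy; rewrite /barrier_weight (mem_I_edges _ exy) (mem_U_edges _ exy).
by rewrite (mem_threshold_edges _ exy) !inE.
Qed.

Lemma threshold_skew t v : 0 < t ->
  [&& (t <= skew v) ==> (t <= loop_dist v),
    (t <= - skew v) ==> (t <= loop_dist v)
    & ~~ ((t <= skew v) && (t <= - skew v))].
Proof.
move=> t0; have pv := skew_loop_dist v; apply/and3P; split.
- by apply/implyP; lra.
- by apply/implyP; lra.
by apply/negP => /andP []; lra.
Qed.

(** For ends in different branches: each end with [loop_dist] below [t] pays one half on its own. *)
Lemma threshold_weight_le t e x y : ends e = [set x; y] -> 0 < t ->
  barrier_weight R (threshold_barrier t) e <=
  2^-1 * ((~~ (t <= loop_dist x)%R)%:R + (~~ (t <= loop_dist y)%R)%:R +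
          (((t <= skew x)%R (+) (t <= - skew y)%R)%:R +
           ((t <= - skew x)%R (+) (t <= skew y)%R)%:R)).
Proof.
move=> exy t0; rewrite (threshold_weightE _ exy) /threshold_rel /in_threshold
  !ltNge.
have := threshold_skew x t0; have := threshold_skew y t0.
case: (t <= loop_dist x); case: (t <= loop_dist y); case: (t <= skew x);
  case: (t <= - skew x); case: (t <= skew y); case: (t <= - skew y);
  case: (_ == _) => //= _ _; lra.
Qed.

(** If both ends have [loop_dist] below [t], they share a branch and [e] is free, so an exclusive or
    replaces the sum. *)
Lemma threshold_weight_le_branch t e x y : ends e = [set x; y] -> 0 < t <= 1 ->
  ~~ [&& loop_dist x < 1, loop_dist y < 1 & branch x != branch y] ->
  barrier_weight R (threshold_barrier t) e <=
  2^-1 * (((t <= loop_dist x)%R (+) (t <= loop_dist y)%R)%:R +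
          (((t <= skew x)%R (+) (t <= - skew y)%R)%:R +
           ((t <= - skew x)%R (+) (t <= skew y)%R)%:R)).
Proof.
move=> exy /andP [t0 t1] nsplit.
have bxy : ~~ (t <= loop_dist x) -> ~~ (t <=
  loop_dist y) -> branch x == branch y.
  rewrite -!ltNge => /lt_le_trans/(_ t1) x1 /lt_le_trans/(_ t1) y1.
  by move: nsplit; rewrite x1 y1 negbK.
rewrite (threshold_weightE _ exy) /threshold_rel /in_threshold !ltNge.
have := threshold_skew x t0; have := threshold_skew y t0.
move: bxy; case: (t <= loop_dist x); case: (t <= loop_dist y);
  case: (t <= skew x);
  case: (t <= - skew x); case: (t <= skew y);
    case: (t <= - skew y) => //= bxy _ _;
  by rewrite ?bxy //=; try case: (_ == _) => /=; lra.
Qed.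

Lemma threshold_weight_avg e :
  avg_le (fun t => barrier_weight R (threshold_barrier t) e) (l e).
Proof.
have [x [y exy]] := endsP e.
have half0 : 0 <= 2^-1 :> R by lra.
have S := avg_leD (avg_le_addb (skew x) (- skew y))
                  (avg_le_addb (- skew x) (- - skew y)).
have lipS := clamp_sym_lipschitz (skew x) (- skew y).
rewrite opprK in S lipS.
have [/and3P [x1 y1 bxy]|nsplit] :=
  boolP [&& loop_dist x < 1, loop_dist y < 1 & branch x != branch y].
  (* Since [t <= 1] always holds, negating [t <= loop_dist x] amounts to an exclusive or with
     [t <= 1]. *)
  have A := avg_leD (avg_le_addb 1 (loop_dist x)) (avg_le_addb 1 (loop_dist y)).
  apply: avg_leW (avg_leZ half0 (avg_leD A S)) _ _.
    by move=> t /andP [t0 t1]; rewrite t1; apply: threshold_weight_le.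
  (* The averaged bound is the maximum over [b] of [1 - dist b x - dist b y], so both parities are
     needed. *)
  have far b : 1 <= dist b x + dist b y + l e.
    by rewrite leNgt; apply: contra bxy => /(branch_edge exy) ->.
  have f0 := far false; have f1 := far true.
  have lipx := clamp_lipschitz 1 (loop_dist x);
    have lipy := clamp_lipschitz 1 (loop_dist y).
  have x1E : `|1 - loop_dist x| = 1 - loop_dist x by rewrite ger0_norm //
    subr_ge0 ltW.
  have y1E : `|1 - loop_dist y| = 1 - loop_dist y by rewrite ger0_norm //
    subr_ge0 ltW.
  have sE : `|skew x + skew y| <=
    2 * l e - (1 - loop_dist x) - (1 - loop_dist y).
    by rewrite ler_norml /skew /loop_dist; lra.
  by lra.
have A := avg_le_addb (loop_dist x) (loop_dist y).
apply: avg_leW (avg_leZ half0 (avg_leD A S)) _ _.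
  by move=> t t01; apply: threshold_weight_le_branch.
have lip := clamp_lipschitz (loop_dist x) (loop_dist y).
have sE : `|loop_dist x - loop_dist y| + `|skew x + skew y| <= 2 * l e.
  have := dist_edge_norm false exy; have := dist_edge_norm true exy.
  rewrite !ler_norml /= => a b.
  have s1 : `|skew x + skew y| <= 2 * l e - (loop_dist x - loop_dist y).
    by rewrite ler_norml /skew /loop_dist; lra.
  have s2 : `|skew x + skew y| <= 2 * l e + (loop_dist x - loop_dist y).
    by rewrite ler_norml /skew /loop_dist; lra.
  by case: (ger0P (loop_dist x - loop_dist y)) => ?; lra.
by lra.
Qed.

Lemma min_barrier_le_length cap c : (forall e, 0 <= cap e) ->
    (forall H, odd_T_walk_barrier T H -> c <= barrier_cap cap H) ->
  c <= \sum_e cap e * l e.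
Proof.
move=> cap0 c_le; pose f t := barrier_cap cap (threshold_barrier t).
apply: (@avg_leP _ f) => [|t t01]; last exact/c_le/threshold_barrierP.
have := avg_le_sum (index_enum (edge G)) (fun e =>
  avg_leZ (cap0 e) (threshold_weight_avg e)).
by move/avg_leW; apply=> // t _; rewrite /f barrier_capE.
Qed.

End Rounding.

(** * Existence of a minimum barrier, and strong duality *)

Lemma min_barrier_exists (R : realType) (G : multigraph) (T :
  {set vertex G}) (cap : edge G -> R) :
  exists2 B, odd_T_walk_barrier T B &
    forall H, odd_T_walk_barrier T H -> barrier_cap cap B <= barrier_cap cap H.
Proof.
(* Pairs of sets form a finite type to minimise over. Discarding the edges not inside the vertex set
   makes any pair a subgraph and leaves pairs coming from a subgraph unchanged. *)
have closed (VE : {set vertex G} * {set edge G}) e :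
    e \in [set e in VE.2 | ends e \subset VE.1] -> ends e \subset VE.1.
  by rewrite inE => /andP [].
pose mk VE := Subgraph (closed VE).
have mkE H : [/\ sub_vertices (mk (sub_vertices H,
  sub_edges H)) = sub_vertices H
    & sub_edges (mk (sub_vertices H, sub_edges H)) = sub_edges H].
  split=> //; apply/setP => e; rewrite inE andbC.
  by case: (boolP (e \in _)) => [/sub_closed ->|]; rewrite ?andbF.
have mk_barrier H : odd_T_walk_barrier T H ->
    odd_T_walk_barrier T (mk (sub_vertices H, sub_edges H)).
  by rewrite /odd_T_walk_barrier; have [-> ->] := mkE H.
have mk_cap H : barrier_cap cap (mk (sub_vertices H,
  sub_edges H)) = barrier_cap cap H.
  by rewrite /barrier_cap /I_edges /U_edges; have [-> ->] := mkE H.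
pose P VE := `[< odd_T_walk_barrier T (mk VE) >].
have P0 : P (T, set0).
  apply/asboolP; split=> // -[[|e W] [[//= _ _] /(_ e)]].
  by rewrite mem_head !inE => /(_ isT).
case: (@arg_minP _ _ _ (T, set0) P (fun VE => barrier_cap cap (mk VE)) P0) =>
  VE /asboolP VE_barrier VE_min.
exists (mk VE) => // H /mk_barrier H_barrier.
by rewrite -(mk_cap H); apply: VE_min; apply/asboolP.
Qed.

Lemma big_option (R : nmodType) (I : finType) (F : option I -> R) :
  \sum_k F k = F None + \sum_i F (Some i).
Proof.
have some_inj : injective (@Some I) by move=> i j [].
rewrite (perm_big (None :: map Some (index_enum I))) /= ?big_cons ?big_map //.
apply: uniq_perm => [||[i|]]; rewrite ?index_enum_uniq //=.
- by rewrite map_inj_uniq // index_enum_uniq andbT; apply/mapP => -[].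
- by rewrite mem_index_enum inE (mem_map some_inj) mem_index_enum.
by rewrite mem_index_enum inE.
Qed.

Lemma packing_of_length_bound (R : realType) (G : multigraph)
    (T : {set vertex G}) (cap : edge G -> R) (c : R) :
    (forall e, 0 <= cap e) -> 0 <= c ->
    (forall l, (forall e, 0 <= l e) ->
       (forall W, odd_T_walk T W -> 1 <= walk_len l W) -> c <=
         \sum_e cap e * l e) ->
  exists2 P, odd_T_walk_packing T cap P & packing_value P = c.
Proof.
move=> cap0 c0 c_le.
pose N := #|{: edge G * vertex G * bool}|.
pose walks := [seq val U | U <- enum {: N.-bseq (edge G)} & `[< odd_T_walk T
  (val U) >]].
have walksP W : W \in walks -> odd_T_walk T W.
  by move=> /mapP [U + ->]; rewrite mem_filter => /andP [/asboolP].
have mem_walks W : odd_T_walk T W -> (size W <= N)%N -> W \in walks.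
  move=> TW sizeW; apply/mapP; exists (Bseq sizeW) => //.
  by rewrite mem_filter mem_enum andbT; apply/asboolP.
pose rows : seq (edge G + seq (edge G)) := map inl (enum (edge G)) ++ map inr
  walks.
pose a (i : edge G + seq (edge G)) (k : option (edge G)) : R :=
  match i, k with
  | inl e, Some f => (f == e)%:R
  | inl e, None => 0
  | inr W, Some f => (count_mem f W)%:R
  | inr W, None => -1
  end.
pose g (k : option (edge G)) : R := if k is Some e then cap e else - c.
have rows_walk W : inr W \in rows -> odd_T_walk T W.
  by rewrite mem_cat => /orP [] /mapP [U] // /walksP TU [->].
have imp x : (forall i, i \in rows -> 0 <= \sum_k a i k * x k) ->
    0 <= \sum_k g k * x k.
  move=> x_rows; pose l e := x (Some e); pose s := x None.
  have l0 e : 0 <= l e.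
    have := x_rows (inl e); rewrite mem_cat map_f ?mem_enum // => /(_ isT).
    rewrite big_option mul0r add0r (bigD1 e) //= eqxx mul1r big1 ?addr0 //.
    by move=> f /negbTE ->; rewrite mul0r.
  have l_short W : odd_T_walk T W -> (size W <= N)%N -> s <= walk_len l W.
    move=> TW sizeW; have := x_rows (inr W); rewrite mem_cat.
    rewrite map_f ?mem_walks // orbT big_option /= walk_len_count => /(_ isT).
    by rewrite mulN1r addrC subr_ge0.
  have l_walk W : odd_T_walk T W -> s <= walk_len l W.
    by move=> /(odd_T_walk_shorten l0) [U [TU sizeU]]; apply: le_trans;
      apply: l_short.
  rewrite big_option /= mulNr addrC subr_ge0.
  (* For [s <= 0] the two sides have opposite signs; for [s > 0] the lengths [l e / s] are
     feasible. *)
  have [s0|s0] := lerP s 0.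
    apply: (@le_trans _ _ 0); first by rewrite mulr_ge0_le0.
    by apply: sumr_ge0 => e _; apply: mulr_ge0 (cap0 e) (l0 e).
  rewrite -ler_pdivlMr // mulr_suml.
  under eq_bigr do rewrite -mulrA.
  apply: (c_le (fun e => l e / s)) => [e|W /l_walk].
    by rewrite divr_ge0 ?l0 ?(ltW s0).
  by rewrite /walk_len -mulr_suml ler_pdivlMr // mul1r.
have [Q [Q_rows gE]] := farkas imp.
pose walk_part (p : R * (edge G + seq (edge G))) :=
  if p.2 is inr W then Some (p.1, W) else None.
exists (pmap walk_part Q); last first.
  (* Coordinate [None] of the Farkas identity gives the value of the packing; coordinate [Some e],
     used below, gives its capacity constraint at [e]. *)
  rewrite /packing_value big_pmap; apply: oppr_inj;
    rewrite -[RHS]/(g None) gE -sumrN.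
  by apply: eq_bigr => -[b [e|W]] _ /=; rewrite ?mulr0 ?oppr0 // mulrN1.
split=> [[b W]|e].
  rewrite mem_pmap => /mapP [[b' [e|U]] // /Q_rows [b0 /rows_walk TU] [-> ->]].
  by split.
rewrite big_pmap -[cap e]/(g (Some e)) gE big_seq [leRHS]big_seq.
apply: ler_sum => -[b [f|W]] /Q_rows [b0 _] //=.
by rewrite mulr_ge0.
Qed.

Theorem theorem12 (R : realType) (G : multigraph) (T : {set vertex G})
    (cap : edge G -> R) (cap_ge0 : forall e : edge G, 0 <= cap e) :
  exists (P : seq (R * seq (edge G))) (B : subgraph G),
    [/\ odd_T_walk_packing T cap P,
        (forall P' : seq (R * seq (edge G)),
           odd_T_walk_packing T cap P' -> packing_value P' <= packing_value P),
        odd_T_walk_barrier T B,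
        (forall B' : subgraph G,
           odd_T_walk_barrier T B' -> barrier_cap cap B <= barrier_cap cap B')
      & packing_value P = barrier_cap cap B].
Proof.
have [B B_barrier B_min] := min_barrier_exists T cap.
have [||P P_packing P_value] := @packing_of_length_bound R G T cap (barrier_cap
  cap B) cap_ge0.
- rewrite barrier_capE; apply: sumr_ge0 => e _.
  by rewrite mulr_ge0 ?barrier_weight_ge0.
- move=> l l0 l_feasible; exact: min_barrier_le_length B_min.
exists P, B; split=> // P' P'_packing.
by rewrite P_value; apply: packing_le_barrier P'_packing B_barrier.
Qed.
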